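(* Let $k$ be a positive integer and let $A_1, \ldots, A_k$ be a partition of $\mathbb{N}$ into $k$ sets. Then for all prime numbers $p$ except at most $k-1$ of them, at least one of the sets $A_1, \ldots, A_k$ is dense in $\mathbb{Z}_p$.
   Context: $\mathbb{N}$ denotes the set of positive integers, viewed as a subset of the ring of $p$-adic integers $\mathbb{Z}_p$; ''dense in $\mathbb{Z}_p$'' refers to the $p$-adic topology. *)

(* Defs.v *)
From HB Require Import structures.
From mathcomp Require Import all_boot all_order all_algebra.
From mathcomp Require Import all_classical all_reals all_analysis.

Set Implicit Arguments.
Unset Strict Implicit.
Unset Printing Implicit Defensive.

Import GRing.Theory.

Local Open Scope classical_set_scope.
Local Open Scope ring_scope.

(* Z_p as the inverse limit of the rings Z / p^(n+1) along the reduction maps.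
   The exponents start at 1 because 'Z_1 is Z / 2Z in zmodp; hence, for p > 1,
   'Z_(p ^ n.+1) really is Z / p^(n+1). The ring and the topology below are
   built for every p : nat, but p is meant to be prime: for p = 0 and p = 1
   padic_int p has no p-adic meaning. *)

Definition padic_compat (p : nat) (x : forall n, 'Z_(p ^ n.+1)) : Prop :=
  forall n, inZp (x n.+1) = x n :> 'Z_(p ^ n.+1).

Record padic_int (p : nat) := PadicInt {
  padic_res :> forall n, 'Z_(p ^ n.+1);
  _ : `[< padic_compat padic_res >] }.

HB.instance Definition _ (p : nat) := [isSub for @padic_res p].
HB.instance Definition _ (p : nat) := [Choice of padic_int p by <:].

Section PadicRing.
Variable p : nat.
Implicit Types x y z : padic_int p.

Lemma padic_resP x : padic_compat x.
Proof. by apply/asboolP; case: x. Qed.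

Lemma padic_eqP x y : (forall n, x n = y n) -> x = y.
Proof. by move=> xy; apply: val_inj; apply: functional_extensionality_dep. Qed.

Lemma padic_dvd_modulus n :
  ((Zp_trunc (p ^ n.+1)).+2 %| (Zp_trunc (p ^ n.+2)).+2)%N.
Proof.
case: (ltnP 1 p) => [p_gt1|]; last first.
  by case: p => [|[|//]] _; rewrite ?exp0n ?exp1n.
rewrite !Zp_cast ?(leq_trans p_gt1) //; try by rewrite -{1}[p]expn1 leq_exp2l.
by rewrite dvdn_exp2l.
Qed.

Let dvdM := padic_dvd_modulus.

Definition padic_zero : padic_int p.
Proof.
by exists (fun=> 0); apply/asboolP => n; apply: val_inj; rewrite /= mod0n.
Defined.

Definition padic_one : padic_int p.
Proof.
exists (fun=> 1); apply/asboolP => n; apply: val_inj.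
by rewrite /= modn_dvdm.
Defined.

Definition padic_opp x : padic_int p.
Proof.
exists (fun n => - x n); apply/asboolP => n; rewrite -(padic_resP x n).
apply: val_inj; rewrite /= modn_dvdm //; apply/eqP.
rewrite -(eqn_modDl (x n.+1)) subnKC ?(ltnW (ltn_ord _)) //.
rewrite -[X in _ == X]modnDml subnKC ?(ltnW (ltn_pmod _ _)) //.
by rewrite modnn; apply: dvdM.
Defined.

Definition padic_add x y : padic_int p.
Proof.
exists (fun n => x n + y n); apply/asboolP => n.
rewrite -(padic_resP x n) -(padic_resP y n); apply: val_inj.
by rewrite /= modn_dvdm // modnDm.
Defined.

Definition padic_mul x y : padic_int p.
Proof.
exists (fun n => x n * y n); apply/asboolP => n.
rewrite -(padic_resP x n) -(padic_resP y n); apply: val_inj.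
by rewrite /= modn_dvdm // modnMm.
Defined.

Fact padic_addA : associative padic_add.
Proof. by move=> x y z; apply: padic_eqP => n; rewrite /= addrA. Qed.

Fact padic_addC : commutative padic_add.
Proof. by move=> x y; apply: padic_eqP => n; rewrite /= addrC. Qed.

Fact padic_add0 : left_id padic_zero padic_add.
Proof. by move=> x; apply: padic_eqP => n; rewrite /= add0r. Qed.

Fact padic_addN : left_inverse padic_zero padic_opp padic_add.
Proof. by move=> x; apply: padic_eqP => n; rewrite /= addNr. Qed.

Fact padic_mulA : associative padic_mul.
Proof. by move=> x y z; apply: padic_eqP => n; rewrite /= mulrA. Qed.

Fact padic_mulC : commutative padic_mul.
Proof. by move=> x y; apply: padic_eqP => n; rewrite /= mulrC. Qed.

Fact padic_mul1 : left_id padic_one padic_mul.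
Proof. by move=> x; apply: padic_eqP => n; rewrite /= mul1r. Qed.

Fact padic_mulDl : left_distributive padic_mul padic_add.
Proof. by move=> x y z; apply: padic_eqP => n; rewrite /= mulrDl. Qed.

Fact padic_one_neq0 : padic_one != padic_zero.
Proof.
by apply/eqP => /(congr1 (fun x : padic_int p => val (x 0%N))).
Qed.

HB.instance Definition _ := GRing.isZmodule.Build (padic_int p)
  padic_addA padic_addC padic_add0 padic_addN.

HB.instance Definition _ := GRing.Zmodule_isComNzRing.Build (padic_int p)
  padic_mulA padic_mulC padic_mul1 padic_mulDl padic_one_neq0.

End PadicRing.

(* The p-adic topology: the subspace topology inherited from the product of the
   finite discrete rings Z / p^(n+1). *)
HB.instance Definition _ (p : nat) := Topological.copy (padic_int p)
  (initial_topology (fun x : padic_int p =>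
     (padic_res x : prod_topology (fun n => discrete_topology 'Z_(p ^ n.+1))))).

(* A set of natural numbers viewed inside Z_p, through n |-> n%:R. *)
Definition padic_image (p : nat) (A : set nat) : set (padic_int p) :=
  [set n%:R | n in A].
Arguments padic_image : clear implicits.

(* Main.v *)
(* If k distinct primes p_1, ..., p_k were exceptional, then for each i some
   residue class modulo a power of p_i would miss A_i; by the Chinese remainder
   theorem some positive integer lies in all k of these classes, hence in none
   of the A_i. *)
Require Import Defs.
From mathcomp Require Import all_boot all_order all_algebra.
From mathcomp Require Import all_classical all_reals all_analysis.

Import GRing.Theory.

Local Open Scope classical_set_scope.
Local Open Scope card_scope.

(** Induction on [n]: the last modulus is coprime to the product of the earlier ones, so the
    two-modulus [chinese] glues its class to the solution already found. *)
Lemma chinese_family (n : nat) (q c : nat -> nat) :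
  (forall i j, (i < n)%N -> (j < n)%N -> i <> j -> coprime (q i) (q j)) ->
  exists m : nat, forall i, (i < n)%N -> m = c i %[mod q i].
Proof.
elim: n => [|n IHn] q_coprime; first by exists 0%N.
case: IHn => [i j lt_in lt_jn|m mE]; first by apply: q_coprime; apply: ltnW.
have qn_coprime : coprime (\prod_(i < n) q i) (q n).
  rewrite coprime_sym; elim/big_ind: _ => [|x y|i _].
  - by rewrite coprimen1.
  - by rewrite coprimeMr => -> ->.
  apply: q_coprime => [//||eq_ni]; first exact: ltnW (ltn_ord i).
  by have := ltn_ord i; rewrite -eq_ni ltnn.
exists (chinese (\prod_(i < n) q i) (q n) m (c n)) => i.
rewrite ltnS leq_eqVlt => /predU1P[->|lt_in]; first exact: chinese_modr.
have dvd_qi : (q i %| \prod_(i < n) q i)%N.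
  by rewrite (bigD1 (Ordinal lt_in)) //= dvdn_mulr.
by rewrite -(mE i lt_in) -(modn_dvdm _ dvd_qi) chinese_modl // modn_dvdm.
Qed.

Lemma padic_res_natr (p m n : nat) : ((m%:R : padic_int p) n = m%:R)%R.
Proof. by elim: m => [//|m IHm]; rewrite !mulrS -IHm. Qed.

Lemma padic_modulus (p n : nat) :
  (1 < p)%N -> (Zp_trunc (p ^ n.+1)).+2 = (p ^ n.+1)%N.
Proof. by move=> p_gt1; rewrite Zp_cast // -[1%N](expn0 p) ltn_exp2l. Qed.

Lemma padic_res_mod (p : nat) (x : padic_int p) (m n : nat) :
  (1 < p)%N -> (m <= n)%N -> x n = x m %[mod p ^ m.+1].
Proof.
move=> p_gt1 le_mn; rewrite -(subnKC le_mn).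
elim: (n - m)%N => [|d IHd]; first by rewrite addn0.
rewrite addnS -IHd -(padic_resP x (m + d)) /= modn_dvdm // padic_modulus //.
by rewrite dvdn_exp2l // ltnS leq_addr.
Qed.

(** Each coordinate of [y] is eventually constant, which is convergence in a discrete factor, and
    the topology is induced from the product of these factors. *)
Lemma padic_cvg (p : nat) (y : nat -> padic_int p) (x : padic_int p) :
  (forall m n, (m <= n)%N -> y n m = x m) -> y @ \oo --> x.
Proof.
move=> yE A [_ [[B openB <-] Bx BA]].
apply: (filterS BA).
pose T := prod_topology (fun n => discrete_topology 'Z_(p ^ n.+1)).
suff yx : (padic_res (p:=p) \o y : nat -> T) @ \oo --> (padic_res x : T).
  by apply: yx; apply: open_nbhs_nbhs.
(* The product topology is a supremum of initial topologies, one per coordinate, so a single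
   coordinate [m] is enough. *)
apply/cvg_sup => m C [_ [[D _ <-] Dx DC]].
by exists m => // n /= le_mn; apply: DC; rewrite /= /proj /= yE.
Qed.

(** Elements of [A] congruent to the residues of a point [x] modulo growing powers of [p] converge
    to [x], hence enter any open set around it. *)
Lemma dense_padic_image (p : nat) (A : set nat) : (1 < p)%N ->
  (forall c n, exists2 a, A a & a = c %[mod p ^ n.+1]) ->
  dense (padic_image p A).
Proof.
move=> p_gt1 A_meets O [x Ox] openO.
pose r n : nat := padic_res x n.
have /choice[a aP] n : exists b, A b /\ b = r n %[mod p ^ n.+1].
  by have [b] := A_meets (r n) n; exists b.
have aE m n : (m <= n)%N -> padic_res ((a n)%:R)%R m = padic_res x m.
  move=> le_mn; rewrite padic_res_natr Zp_nat; apply: val_inj => /=.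
  have dvd_mn : (p ^ m.+1 %| p ^ n.+1)%N by rewrite dvdn_exp2l.
  rewrite [X in (_ %% X)%N]padic_modulus // -(modn_dvdm _ dvd_mn).
  rewrite (aP n).2 modn_dvdm //.
  rewrite (padic_res_mod _ _ _ _ p_gt1 le_mn) // modn_small //.
  by rewrite -[X in (_ < X)%N](padic_modulus _ m p_gt1).
have [N _ O_a] := padic_cvg _ _ _ aE O (open_nbhs_nbhs (conj openO Ox)).
exists (a N)%:R%R; split; first exact: O_a (leqnn N).
by exists (a N); first by case: (aP N).
Qed.

(** Turns the failure of an upper bound on the cardinality into [n.+1] distinct elements, whether
    [S] is finite or infinite. *)
Lemma card_le_II_or_gt (T : pointedType) (S : set T) (n : nat) :
  S #<= `I_n \/ `I_n.+1 #<= S.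
Proof.
have [/finite_setP[m Sm]|Sinf] := pselect (finite_set S).
  have [le_mn|lt_nm] := leqP m n; [left|right].
    by rewrite (card_le_eql Sm) card_le_II.
  by rewrite (card_le_eqr Sm) card_le_II.
right; apply: card_le_trans (subset_card_le (@subsetT _ _)) _.
exact/infiniteP.
Qed.

Theorem theorem2p1 (k : nat) (k_gt0 : (0 < k)%N) (A : 'I_k -> set nat)
    (partA : partition [set: 'I_k] A [set n | (0 < n)%N]) :
  [set p : nat | prime p /\ ~ exists i : 'I_k, dense (padic_image p (A i))]
    #<= `I_(k - 1).
Proof.
set S := [set p | _].
(* Otherwise an injection [f] lists [k] distinct exceptional primes. *)
have [//|] := card_le_II_or_gt _ S (k - 1);
  rewrite subn1 prednK // => /pcard_leP[f].
have Sf i : (i < k)%N -> S (f i) by move=> lt_ik; apply: funS.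
have missed (i : 'I_k) : exists cn : nat * nat,
    forall a, A i a -> a <> cn.1 %[mod f i ^ cn.2.+1].
  have [f_prime f_bad] := Sf i (ltn_ord i).
  apply: contrapT => no_cn; apply: f_bad; exists i.
  apply: dense_padic_image => [|c n]; first exact: prime_gt1.
  apply: contrapT => no_a; apply: no_cn; exists (c, n) => a Aa aE.
  by apply: no_a; exists a.
have [cn cnP] := choice missed.
(* [chinese_family] is indexed by [nat] and [cn] by ['I_k]; the default [i0] is only taken for
   indices at least [k]. *)
pose i0 := Ordinal k_gt0.
pose q j := (f j ^ (cn (insubd i0 j)).2.+1)%N.
have q_gt0 (i : 'I_k) : (0 < q i)%N.
  by rewrite expn_gt0 prime_gt0 //; case: (Sf i (ltn_ord i)).
have [i j lt_ik lt_jk ne_ij|m mE] :=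
    @chinese_family k q (fun j => (cn (insubd i0 j)).1).
  rewrite coprimeXl // coprimeXr //.
  have [[pi _] [pj _]] := (Sf i lt_ik, Sf j lt_jk).
  rewrite prime_coprime // dvdn_prime2 //; apply/eqP => eq_f; apply: ne_ij.
  by apply: (inj (f := f)) eq_f; rewrite inE.
have [covA _ _] := partA.
(* The solution [m] may be 0; adding the product of the moduli makes it positive and keeps every
   residue. *)
have : cover [set: 'I_k] A (m + \prod_(i < k) q i)%N.
  by rewrite covA /= addn_gt0 prodn_gt0 ?orbT.
case=> i _ Ai; case: (cnP i _ Ai).
have := mE i (ltn_ord i); rewrite /q valKd => <-.
by rewrite (bigD1 i) //= /q valKd -modnDmr modnMr addn0.
Qed.
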